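(* Let $n\geq 1$, let $\mathbf{c}=(c_1,\dots,c_n)\in\mathbb{Z}_{>0}^n$ and let $k$ be an integer with $0<k<c_1+\cdots+c_n$. Then the polytope $\mathscr{R}_{k,\mathbf{c}}$ is Ehrhart positive: its Ehrhart polynomial $\operatorname{ehr}(\mathscr{R}_{k,\mathbf{c}},t)$, which has degree $n-1$, has all of its coefficients (of $t^0,t^1,\dots,t^{n-1}$) positive.
   Context: For $\mathbf{c}=(c_1,\dots,c_n)\in\mathbb{Z}_{>0}^n$ and $k\in\mathbb{Z}_{>0}$, the slice of prism is $\mathscr{R}_{k,\mathbf{c}}=\{x\in\mathbb{R}^n : 0\le x_i\le c_i \text{ for all } i,\ \sum_{i=1}^n x_i=k\}$; it is a lattice polytope. For a lattice polytope $\mathscr{P}\subseteq\mathbb{R}^n$, the Ehrhart polynomial $\operatorname{ehr}(\mathscr{P},t)$ is the unique polynomial with $\operatorname{ehr}(\mathscr{P},t)=\#(t\mathscr{P}\cap\mathbb{Z}^n)$ for all positive integers $t$. *)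

(* Defs.v *)
From HB Require Import structures.
From mathcomp Require Import all_boot all_order all_algebra.
From mathcomp Require Import all_classical all_reals.

Set Implicit Arguments.
Unset Strict Implicit.
Unset Printing Implicit Defensive.

Import Order.TTheory GRing.Theory Num.Theory.

Local Open Scope classical_set_scope.
Local Open Scope card_scope.
Local Open Scope ring_scope.

Definition prism_slice (R : realType) (n k : nat) (c : 'I_n -> nat) :
    set 'rV[R]_n :=
  [set x | (forall i, 0 <= x ord0 i <= (c i)%:R) /\
           \sum_(i < n) x ord0 i = k%:R].

Definition dilate (R : realType) (n t : nat) (P : set 'rV[R]_n) :
    set 'rV[R]_n :=
  [set t%:R *: x | x in P].

Definition lattice (R : realType) (n : nat) : set 'rV[R]_n :=
  [set x | forall i, x ord0 i \is a Num.int].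

Definition counts_lattice_points (R : realType) (n : nat)
    (P : set 'rV[R]_n) (p : {poly R}) : Prop :=
  forall t : nat, (0 < t)%N ->
    exists2 m : nat, dilate t P `&` @lattice R n #= `I_m & p.[t%:R] = m%:R.

Definition ehrhart_polynomial (R : realType) (n : nat)
    (P : set 'rV[R]_n) (p : {poly R}) : Prop :=
  unique (counts_lattice_points P) p.

(* Main.v *)
Require Import Defs.
From HB Require Import structures.
From mathcomp Require Import all_boot all_order all_algebra.
From mathcomp Require Import zify ring.
From mathcomp Require Import finmap.
From mathcomp Require Import all_classical all_reals.

Set Implicit Arguments.
Unset Strict Implicit.
Unset Printing Implicit Defensive.

Import Order.TTheory GRing.Theory Num.Theory.

Local Open Scope classical_set_scope.
Local Open Scope card_scope.
Local Open Scope ring_scope.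

(* Write n for the length of c, and c(S) for the sum of the entries of c at the
   positions in S. Inclusion-exclusion counts the lattice points of t R_{k,c} as
     p(t) = 1/(n-1)! sum_{S : c(S) < k} (-1)^|S|
              prod_{0 < j < n} (t (k - c(S)) + j - |S|),
   so that (n-1)! [t^m] p is the coefficient of X^k in
     (sum_S (-1)^|S| X^(c(S)) [z^m] prod_{0 < j < n} (z + j - |S|))
       * sum_{j >= 1} j^m X^j.
   The second factor is X A_m(X) / (1 - X)^(m+1), with A_m the Eulerian
   polynomial. The first one is the sum over the permutations of the n positions
   with m + 1 cycles of the product of 1 - X^(c(C)) over the cycles C, hence it
   is (1 - X)^(m+1) W(X) where W has nonnegative coefficients. The powers of
   1 - X cancel, and W(X) X A_m(X) has positive coefficients in degrees 1, ...,
   c_1 + ... + c_n - 1. Permutations never appear explicitly: W is built by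
   recursion on n, the first position being either a fixed point or merged into
   the position that it follows in its cycle. *)

Lemma coefX_deriv (R : nzRingType) (p : {poly R}) (i : nat) :
  ('X * p^`())`_i = i%:R * p`_i.
Proof.
by rewrite coefXM; case: i => [|i]; rewrite ?mul0r // coef_deriv mulr_natl.
Qed.

Lemma leq_size_sumn (c : seq nat) : all (leq 1) c -> (size c <= sumn c)%N.
Proof. by elim: c => //= a c IH /andP[a0 /IH]; lia. Qed.

Lemma coef_comp_polyZX (R : comNzRingType) (p : {poly R}) (a : R) (m : nat) :
  (p \Po (a *: 'X))`_m = a ^+ m * p`_m.
Proof.
rewrite comp_polyE.
under eq_bigr => i _ do rewrite exprZn scalerA [p`_i * _]mulrC.
rewrite -(poly_def _ (fun i => a ^+ i * p`_i)) coef_poly.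
by case: ltnP => // mp; rewrite nth_default ?mulr0.
Qed.

(* The closure properties of polyOver are attached to predicates, not to the
   qualifier Num.nneg. *)
Lemma coefM_gt0 (R : numDomainType) (p q : {poly R}) (i j : nat) :
  p \is a polyOver Num.Def.nneg_num_pred ->
  q \is a polyOver Num.Def.nneg_num_pred ->
  0 < p`_i -> 0 < q`_j -> 0 < (p * q)`_(i + j).
Proof.
move=> /polyOverP p_ge0 /polyOverP q_ge0 pi qj; rewrite coefM.
have ij : (i < (i + j).+1)%N by rewrite ltnS leq_addr.
rewrite (bigD1 (Ordinal ij)) //= addKn ltr_wpDr ?mulr_gt0 //.
by apply: sumr_ge0 => l _; apply: mulr_ge0; [exact: p_ge0|exact: q_ge0].
Qed.

Lemma horner_posnat_inj (R : numDomainType) (p q : {poly R}) :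
  (forall t : nat, (0 < t)%N -> p.[t%:R] = q.[t%:R]) -> p = q.
Proof.
move=> pq; apply/eqP; rewrite -subr_eq0; apply/eqP.
apply: (@roots_geq_poly_eq0 _ _ [seq i.+1%:R | i <- iota 0 (size (p - q))]).
- by apply/allP => _ /mapP[i _ ->]; rewrite rootE !hornerE pq ?subrr.
- rewrite map_inj_uniq ?iota_uniq // => i j /eqP.
  by rewrite eqr_nat eqSS => /eqP.
- by rewrite size_map size_iota.
Qed.

(* The coefficient of X^k in the product of p by the formal power series
   sum_j f(j) X^j, of which only the terms of degree at most k matter. *)
Definition coef_mulps (R : nzRingType) (f : nat -> R) (k : nat)
    (p : {poly R}) : R :=
  (p * \poly_(i < k.+1) f i)`_k.

Section PowerSeriesAction.

Variable R : comNzRingType.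
Implicit Types (f : nat -> R) (p q : {poly R}).

Lemma coef_mulpsE f k p :
  coef_mulps f k p = \sum_(i < k.+1) p`_i * f (k - i)%N.
Proof.
rewrite /coef_mulps coefM; apply: eq_bigr => i _.
by rewrite coef_poly ltnS leq_subr.
Qed.

Fact coef_mulps_is_linear f k : linear_for *%R (coef_mulps f k).
Proof. by move=> a p q; rewrite /coef_mulps mulrDl -scalerAl coefD coefZ. Qed.

HB.instance Definition _ f k :=
  GRing.isLinear.Build R {poly R} R *%R (coef_mulps f k)
    (coef_mulps_is_linear f k).

Lemma eq_coef_mulps f g k p :
  f =1 g -> coef_mulps f k p = coef_mulps g k p.
Proof.
by move=> fg; rewrite !coef_mulpsE; apply: eq_bigr => i _; rewrite fg.
Qed.

Lemma coef_mulps_sumf (n : nat) (a : 'I_n -> R) (F : 'I_n -> nat -> R) k p :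
  coef_mulps (fun j => \sum_i a i * F i j) k p =
  \sum_i a i * coef_mulps (F i) k p.
Proof.
rewrite coef_mulpsE.
under [RHS]eq_bigr => i _ do rewrite coef_mulpsE mulr_sumr.
rewrite exchange_big; apply: eq_bigr => u _; rewrite mulr_sumr.
by apply: eq_bigr => i _; rewrite mulrCA.
Qed.

Lemma coef_mulpsM f k p q :
  coef_mulps f k (p * q) = coef_mulps (coef_mulps f ^~ q) k p.
Proof.
rewrite [RHS]coef_mulpsE /coef_mulps -mulrA coefM; apply: eq_bigr => i _.
congr (_ * _); rewrite !coefM; apply: eq_bigr => j _; rewrite !coef_poly.
by rewrite !ifT //; have := ltn_ord i; have := ltn_ord j; lia.
Qed.

Lemma coef_mulpsXn f k n :
  coef_mulps f k 'X^n = if (n <= k)%N then f (k - n)%N else 0.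
Proof.
by rewrite /coef_mulps coefXnM coef_poly ltnS leq_subr; case: leqP.
Qed.

Lemma coef_mulps1 f k : coef_mulps f k 1 = f k.
Proof. by rewrite -(expr0 'X) coef_mulpsXn subn0. Qed.

Lemma coef_mulpsX f k :
  coef_mulps f k 'X = if k is k'.+1 then f k' else 0.
Proof. by rewrite (coef_mulpsXn f k 1); case: k => // k; rewrite subn1. Qed.

Lemma coef_mulps_1subX f k :
  coef_mulps f k (1 - 'X) = f k - (if k is k'.+1 then f k' else 0).
Proof. by rewrite raddfB /= coef_mulps1 coef_mulpsX. Qed.

Lemma coef_mulps_delta k p : coef_mulps (fun j => (j == 0)%:R) k p = p`_k.
Proof.
rewrite coef_mulpsE big_ord_recr /= subnn mulr1 big1 ?add0r // => i _.
by rewrite subn_eq0 leqNgt ltn_ord mulr0.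
Qed.

Lemma coef_mulps_leibniz f k p :
  k%:R * coef_mulps f k p =
  coef_mulps f k ('X * p^`()) + coef_mulps (fun j => j%:R * f j) k p.
Proof.
rewrite !coef_mulpsE mulr_sumr -big_split; apply: eq_bigr => -[i ik] _ /=.
by rewrite coefX_deriv natrB //; ring.
Qed.

Lemma coef_mulps_decimate f t k s q : (0 < t)%N ->
  coef_mulps f (t * k) ((q \Po 'X^t) * 'X^s) =
  coef_mulps (fun j => if (s <= t * j)%N then f (t * j - s)%N else 0) k q.
Proof.
move=> t0; rewrite -[q]coefK poly_def [RHS]linear_sum.
rewrite (raddf_sum (comp_poly 'X^t)) mulr_suml linear_sum.
apply: eq_bigr => u _.
rewrite linearZ /= comp_polyZ comp_Xn_poly -scalerAl linearZ -exprM -exprD /=.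
rewrite !coef_mulpsXn; congr (_ * _); rewrite mulnBr.
case: (leqP u k) => uk.
  by rewrite subnDA -leq_subRL // leq_mul2l uk orbT.
by rewrite ifF //; apply: negbTE; rewrite -ltnNge ltn_addr // ltn_pmul2l.
Qed.

Lemma coef_mulps_bin n k p :
  coef_mulps (fun j => 'C(j + n, n)%:R) k ((1 - 'X) ^+ n.+1 * p) = p`_k.
Proof.
rewrite mulrC coef_mulpsM -(coef_mulps_delta k p); apply: eq_coef_mulps.
elim: n => [|n IHn] j.
  rewrite expr1 coef_mulps_1subX.
  by case: j => [|j]; rewrite !bin0 ?subr0 ?subrr.
rewrite exprSr coef_mulpsM -IHn; apply: eq_coef_mulps => i.
rewrite coef_mulps_1subX; case: i => [|i]; first by rewrite !add0n !binn subr0.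
by rewrite addnS binS addSnnS natrD addrAC subrr add0r.
Qed.

End PowerSeriesAction.

(* The factor [0 < j] matters for m = 0, as 0 ^+ 0 = 1. *)
Definition power_seq (R : nzRingType) (m j : nat) : R :=
  (0 < j)%:R * j%:R ^+ m.

(* The coefficient of X^k in X A_m(X), with A_m the Eulerian polynomial. *)
Definition eulerian (R : nzRingType) (m k : nat) : R :=
  coef_mulps (power_seq R m) k ((1 - 'X) ^+ m.+1).

Lemma eulerian_0n (R : comNzRingType) (k : nat) : eulerian R 0 k = (k == 1)%:R.
Proof.
rewrite /eulerian expr1 coef_mulps_1subX /power_seq.
by case: k => [|[|k]]; rewrite !expr0 !mulr1 ?subr0 ?subrr.
Qed.

Lemma eulerian_n0 (R : comNzRingType) (m : nat) : eulerian R m 0 = 0.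
Proof.
rewrite /eulerian coef_mulpsE big_ord_recl big_ord0.
by rewrite /power_seq mul0r mulr0 addr0.
Qed.

(* With f = sum_j j^m X^j, this is the recurrence
   (1 - X)^(m+2) (X f') = (1 - X) X A' + (m + 1) X A for A = (1 - X)^(m+1) f. *)
Lemma eulerian_SS (R : comNzRingType) (m k : nat) :
  eulerian R m.+1 k.+1 =
  k.+1%:R * eulerian R m k.+1 + (m.+1%:R - k%:R) * eulerian R m k.
Proof.
pose P : {poly R} := (1 - 'X) ^+ m.+1.
have derivP : (1 - 'X) * ('X * P^`()) = - m.+1%:R *: ('X * P).
  rewrite /P deriv_exp derivB derivX derivC sub0r mulN1r exprS.
  by rewrite -mulr_natl -polyC_natr -mul_polyC polyCN; ring.
have powerS j : coef_mulps (power_seq R m.+1) j P =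
    j%:R * eulerian R m j - coef_mulps (power_seq R m) j ('X * P^`()).
  rewrite /eulerian coef_mulps_leibniz [X in X - _]addrC addrK.
  by apply: eq_coef_mulps => i; rewrite /power_seq exprS; ring.
have := congr1 (coef_mulps (power_seq R m) k.+1) derivP.
rewrite coef_mulpsM coef_mulps_1subX linearZ /=.
rewrite [in RHS]coef_mulpsM coef_mulpsX -/(eulerian R m k).
move/eqP; rewrite subr_eq => /eqP derivP_coef.
rewrite {1}/eulerian exprS coef_mulpsM coef_mulps_1subX !powerS.
by rewrite derivP_coef; ring.
Qed.

Lemma eulerian_eq0 (R : comNzRingType) (m k : nat) :
  (maxn m 1 < k)%N -> eulerian R m k = 0.
Proof.
elim: m k => [|m IHm] [|k] //; rewrite ?eulerian_0n; first by case: k.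
rewrite eulerian_SS => mk; rewrite IHm ?mulr0 ?add0r; last by lia.
have [->|km] := eqVneq k m.+1; first by rewrite subrr mul0r.
by rewrite IHm ?mulr0 //; lia.
Qed.

Lemma eulerian_ge0 (R : numDomainType) (m k : nat) : 0 <= eulerian R m k.
Proof.
elim: m k => [|m IHm] [|k]; rewrite ?eulerian_n0 ?eulerian_0n //.
rewrite eulerian_SS addr_ge0 //; first by rewrite mulr_ge0 ?ler0n.
have [km|mk] := leqP k m.+1; first by rewrite mulr_ge0 // subr_ge0 ler_nat.
by rewrite eulerian_eq0 ?mulr0 //; lia.
Qed.

Lemma eulerian_gt0 (R : numDomainType) (m k : nat) :
  (0 < k <= maxn m 1)%N -> 0 < eulerian R m k.
Proof.
elim: m k => [|m IHm] [|k] // km; first by rewrite eulerian_0n; case: k km.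
rewrite eulerian_SS; have [km1|mk] := leqP k.+1 (maxn m 1).
  rewrite ltr_wpDr ?mulr_gt0 ?ltr0n ?IHm // mulr_ge0 ?eulerian_ge0 //.
  by rewrite subr_ge0 ler_nat; lia.
rewrite ltr_wpDl ?mulr_ge0 ?ler0n ?eulerian_ge0 // mulr_gt0 //.
  by rewrite subr_gt0 ltr_nat; lia.
by apply: IHm; lia.
Qed.

Definition geom_poly (R : nzRingType) (a : nat) : {poly R} := \sum_(i < a) 'X^i.

Lemma geom_polyE (R : comNzRingType) (a : nat) :
  (1 - 'X) * geom_poly R a = 1 - 'X^a.
Proof. by rewrite -opprB mulNr -subrX1 opprB. Qed.

Lemma coef_geom_poly (R : nzRingType) (a i : nat) :
  (geom_poly R a)`_i = (i < a)%:R.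
Proof.
rewrite /geom_poly; under eq_bigr do rewrite -[_ ^+ _]scale1r.
by rewrite -(poly_def _ (fun=> 1)) coef_poly; case: ifP.
Qed.

Fixpoint merges (a : nat) (c : seq nat) : seq (seq nat) :=
  if c is b :: c' then (a + b :: c')%N :: map (cons b) (merges a c') else [::].

Lemma size_merges (a : nat) (c d : seq nat) :
  d \in merges a c -> size d = size c.
Proof.
elim: c d => [|b c IHc] d //=; rewrite in_cons.
by case/predU1P => [-> //|/mapP[e /IHc se ->]]; rewrite /= se.
Qed.

(* The coefficient of X^u in that of Y^s is (-1)^s times the number of
   s-element sets of positions in c at which the entries of c sum to u. *)
Definition subset_poly (R : nzRingType) (c : seq nat) : {poly {poly R}} :=
  \prod_(a <- c) (1 - 'X^a *: 'X).

Section SubsetPoly.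

Variable R : comNzRingType.

Lemma subset_poly_cons (a : nat) (c : seq nat) :
  subset_poly R (a :: c) = (1 - 'X^a *: 'X) * subset_poly R c.
Proof. by rewrite /subset_poly big_cons. Qed.

Lemma coef0_subset_poly (c : seq nat) : (subset_poly R c)`_0 = 1.
Proof.
rewrite -horner_coef0 horner_prod big1_seq // => a _.
by rewrite !hornerE subr0.
Qed.

Lemma size_subset_poly (c : seq nat) :
  (size (subset_poly R c) <= (size c).+1)%N.
Proof.
elim: c => [|a c IHc]; first by rewrite /subset_poly big_nil size_poly1.
rewrite subset_poly_cons (leq_trans (size_polyMleq _ _)) //.
have lin_size : (size (1 - 'X^a *: 'X : {poly {poly R}})%R <= 2)%N.
  rewrite (leq_trans (size_polyD _ _)) // geq_max size_poly1 size_polyN.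
  by rewrite (leq_trans (size_scale_leq _ _)) ?size_polyX.
by rewrite -subn1 leq_subLR (leq_add lin_size IHc).
Qed.

Lemma sum_subset_poly_merges (a : nat) (c : seq nat) :
  \sum_(d <- merges a c) subset_poly R d =
  (size c)%:R *: subset_poly R c - (1 - 'X^a) *: ('X * (subset_poly R c)^`()).
Proof.
elim: c => [|b c IHc].
  by rewrite /subset_poly !big_nil /= scale0r derivE mulr0 scaler0 subrr.
rewrite /= big_cons big_map !subset_poly_cons.
under eq_bigr do rewrite subset_poly_cons.
rewrite -mulr_sumr IHc derivM derivB derivC derivZ derivX -natr1 exprD.
rewrite -!mul_polyC !(polyCB, polyCD, polyCM); ring.
Qed.

Lemma prod_1subXn_subset_poly (t : nat) (c : seq nat) :
  \prod_(a <- c) (1 - 'X^(t * a + 1)) =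
  \sum_(s < (size c).+1) ((subset_poly R c)`_s \Po 'X^t) * 'X^s.
Proof.
transitivity (map_poly (comp_poly 'X^t) (subset_poly R c)).['X]; last first.
  rewrite (@horner_coef_wide _ (size c).+1).
    by apply: eq_bigr => s _; rewrite coef_map.
  exact: leq_trans (size_poly _ _) (size_subset_poly c).
rewrite rmorph_prod horner_prod; apply: eq_bigr => a _ /=.
rewrite rmorphB rmorph1 /= map_polyZ /= map_polyX comp_Xn_poly !hornerE.
by rewrite exprD exprM expr1.
Qed.

End SubsetPoly.

Definition shifted_rise (A : nzRingType) (n s : nat) : {poly A} :=
  \prod_(1 <= j < n) ('X + (j%:R - s%:R)%:P).

Lemma shifted_rise_Sn (A : nzRingType) (n s : nat) : (0 < n)%N ->
  shifted_rise A n.+1 s = shifted_rise A n s * ('X + (n%:R - s%:R)%:P).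
Proof. by move=> n0; rewrite /shifted_rise big_nat_recr. Qed.

Lemma shifted_rise_SS (A : comNzRingType) (n s : nat) : (0 < n)%N ->
  shifted_rise A n.+1 s.+1 = shifted_rise A n s * ('X - s%:R%:P).
Proof.
move=> n0; rewrite /shifted_rise big_add1 /=.
under eq_bigr do rewrite -!natr1 opprD addrACA subrr addr0.
by rewrite big_ltn // sub0r polyCN mulrC.
Qed.

Lemma map_shifted_rise (A B : nzRingType) (f : {rmorphism A -> B}) (n s : nat) :
  map_poly f (shifted_rise A n s) = shifted_rise B n s.
Proof.
rewrite rmorph_prod; apply: eq_bigr => j _ /=.
by rewrite rmorphD /= map_polyX map_polyC /= rmorphB /= !rmorph_nat.
Qed.

Lemma size_shifted_rise (A : idomainType) (n s : nat) : (0 < n)%N ->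
  size (shifted_rise A n s) = n.
Proof.
case: n => // n _; rewrite /shifted_rise.
under eq_bigr => j _ do rewrite -opprB polyCN.
by rewrite size_prod_XsubC size_iota subSS subn0.
Qed.

Lemma horner_shifted_rise (R : numFieldType) (n s y : nat) :
  (0 < n)%N -> (s <= n)%N -> (0 < y)%N ->
  (n.-1)`!%:R^-1 * (shifted_rise R n s).[y%:R] =
  if (s <= y)%N then 'C(y - s + n.-1, n.-1)%:R else 0.
Proof.
move=> n0 sn y0; rewrite /shifted_rise horner_prod.
under eq_bigr do rewrite hornerD hornerX hornerC addrA.
case: leqP => sy; last first.
  rewrite (bigD1_seq (s - y)%N) ?iota_uniq //=.
    by rewrite -natrD subnKC 1?ltnW // subrr mul0r mulr0.
  by rewrite mem_index_iota; lia.
have -> : \prod_(1 <= j < n) (y%:R + j%:R - s%:R) =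
   ((y - s + n.-1) ^_ n.-1)%:R :> R.
  rewrite ffact_prod natr_prod -(prednK n0) big_add1 /= big_nat_rev /=.
  rewrite big_mkord.
  apply: eq_bigr => i _; have := ltn_ord i => iN.
  have -> : (y - s + n.-1 - i = y + (n.-1 - i.+1).+1 - s)%N by lia.
  by rewrite add0n natrB ?natrD //; lia.
by rewrite -bin_ffact natrM mulrC mulfK // pnatr_eq0 -lt0n fact_gt0.
Qed.

Definition shifted_rise_subst (A : nzRingType) (n : nat) (q : {poly A}) :
    {poly A} :=
  \sum_(s < n.+1) q`_s *: shifted_rise A n s.

Section ShiftedRiseSubst.

Variable A : comNzRingType.
Implicit Types (n : nat) (q : {poly A}).

Fact shifted_rise_subst_is_linear n : linear (@shifted_rise_subst A n).
Proof.
move=> a p q; rewrite /shifted_rise_subst scaler_sumr -big_split.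
by apply: eq_bigr => s _; rewrite /= coefD coefZ scalerDl scalerA.
Qed.

HB.instance Definition _ n :=
  GRing.isLinear.Build A {poly A} {poly A} *:%R (@shifted_rise_subst A n)
    (shifted_rise_subst_is_linear n).

Lemma shifted_rise_subst_mul1subZX n (b : A) q :
  (0 < n)%N -> (size q <= n.+1)%N ->
  shifted_rise_subst n.+1 ((1 - b *: 'X) * q) =
  ((1 - b) *: 'X) * shifted_rise_subst n q
  + shifted_rise_subst n (n%:R *: q - (1 - b) *: ('X * q^`())).
Proof.
move=> n0 szq.
have substS : shifted_rise_subst n.+1 q =
    \sum_(s < n.+1) q`_s *: (shifted_rise A n s * ('X + (n%:R - s%:R)%:P)).
  rewrite /shifted_rise_subst big_ord_recr /= nth_default // scale0r addr0.
  by apply: eq_bigr => s _; rewrite shifted_rise_Sn.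
have substSX : shifted_rise_subst n.+1 ('X * q) =
    \sum_(s < n.+1) q`_s *: (shifted_rise A n s * ('X - s%:R%:P)).
  rewrite /shifted_rise_subst big_ord_recl coefXM scale0r add0r.
  by apply: eq_bigr => s _; rewrite coefXM /= shifted_rise_SS.
rewrite mulrBl mul1r -scalerAl [LHS]linearB linearZ /= substS substSX.
rewrite scaler_sumr -sumrB mulr_sumr -big_split; apply: eq_bigr => -[s sn] _ /=.
have -> : (n%:R *: q - (1 - b) *: ('X * q^`()))`_s =
    (n%:R - (1 - b) * s%:R) * q`_s.
  by rewrite coefB !coefZ coefX_deriv; ring.
rewrite -!mul_polyC !(polyCB, polyCM); ring.
Qed.

End ShiftedRiseSubst.

(* The sum over the permutations of the positions of c of the product over
   their cycles C of z (1 - X^(c(C))), divided by z, where c(C) is the sum of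
   the entries of c along C. Expanding 1 - X^(c(C)) selects a stable set S of s
   positions, and the permutations of S and of its complement contribute
   z (z - 1) ... (z - s + 1) * z (z + 1) ... (z + n - s - 1), up to sign, which
   is z times shifted_rise n s. *)
Definition cycle_poly (R : nzRingType) (c : seq nat) : {poly {poly R}} :=
  shifted_rise_subst (size c) (subset_poly R c).

Lemma coef_cycle_poly (R : comNzRingType) (c : seq nat) (m : nat) :
  (cycle_poly R c)`_m =
  \sum_(s < (size c).+1) (shifted_rise R (size c) s)`_m *: (subset_poly R c)`_s.
Proof.
rewrite coef_sum; apply: eq_bigr => s _.
by rewrite coefZ -(map_shifted_rise polyC) coef_map mulrC mul_polyC.
Qed.

Lemma cycle_poly1 (R : comNzRingType) (a : nat) :
  cycle_poly R [:: a] = (1 - 'X^a)%:P.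
Proof.
rewrite /cycle_poly /subset_poly big_seq1 /shifted_rise_subst.
under eq_bigr do rewrite /shifted_rise big_geq //.
rewrite big_ord_recl big_ord_recl big_ord0 addr0.
rewrite !coefB !coefZ !coef1 !coefX mulr0 subr0 mulr1 sub0r -scalerDl.
by rewrite -mul_polyC mulr1.
Qed.

(* Deleting one element, which is either a fixed point or follows another
   element in its cycle. *)
Lemma cycle_poly_cons (R : comNzRingType) (a : nat) (c : seq nat) :
  (0 < size c)%N ->
  cycle_poly R (a :: c) =
  ((1 - 'X^a) *: 'X) * cycle_poly R c + \sum_(d <- merges a c) cycle_poly R d.
Proof.
move=> c0; rewrite /cycle_poly subset_poly_cons.
rewrite shifted_rise_subst_mul1subZX ?size_subset_poly //.
rewrite -sum_subset_poly_merges linear_sum; congr (_ + _).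
by apply: eq_big_seq => d /size_merges ->.
Qed.

(* The fuel n stands for (size c).-1: the lists in merges a c' are not subterms
   of c. *)
Fixpoint cycle_weight_rec (R : nzRingType) (n : nat) (c : seq nat) :
    {poly {poly R}} :=
  if n is n'.+1 then
    if c is a :: (_ :: _) as c' then
      (geom_poly R a *: 'X) * cycle_weight_rec R n' c'
      + \sum_(d <- merges a c') cycle_weight_rec R n' d
    else 0
  else (geom_poly R (sumn c))%:P.

Definition cycle_weight (R : nzRingType) (c : seq nat) : {poly {poly R}} :=
  cycle_weight_rec R (size c).-1 c.

Lemma cycle_weight1 (R : nzRingType) (a : nat) :
  cycle_weight R [:: a] = (geom_poly R a)%:P.
Proof. by rewrite /cycle_weight /= addn0. Qed.

Lemma cycle_weight_cons (R : nzRingType) (a : nat) (c : seq nat) :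
  (0 < size c)%N ->
  cycle_weight R (a :: c) =
  (geom_poly R a *: 'X) * cycle_weight R c
  + \sum_(d <- merges a c) cycle_weight R d.
Proof.
case: c => // b c _; congr (_ + _); apply: eq_big_seq => d /size_merges sd.
by rewrite /cycle_weight sd.
Qed.

Lemma merges_ind (P : seq nat -> Prop) :
  (forall a, P [:: a]) ->
  (forall a c, (0 < size c)%N -> P c -> {in merges a c, forall d, P d} ->
     P (a :: c)) ->
  forall c, (0 < size c)%N -> P c.
Proof.
move=> P1 Pcons c; have [n] := ubnP (size c); elim: n c => // n IHn.
move=> [|a [|b c]] //; rewrite ltnS => cn _; apply: Pcons => // [|d d_merge].
  exact: IHn.
by apply: IHn; rewrite (size_merges d_merge).
Qed.

Lemma cycle_poly_weight (R : comNzRingType) (c : seq nat) : (0 < size c)%N ->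
  cycle_poly R c = (1 - 'X) *: (cycle_weight R c \Po ((1 - 'X) *: 'X)).
Proof.
elim/merges_ind => {c} [a|a c c0 IHc IHmerges].
  by rewrite cycle_poly1 cycle_weight1 comp_polyC -mul_polyC -polyCM geom_polyE.
rewrite (cycle_poly_cons _ _ c0) (cycle_weight_cons _ _ c0).
rewrite comp_polyD comp_polyM.
rewrite (raddf_sum (comp_poly _)) comp_polyZ comp_polyX scalerDr scaler_sumr.
congr (_ + _); last exact: eq_big_seq.
by rewrite IHc -geom_polyE -!mul_polyC polyCM; ring.
Qed.

Lemma coef_cycle_poly_weight (R : comNzRingType) (c : seq nat) (m : nat) :
  (0 < size c)%N ->
  (cycle_poly R c)`_m = (cycle_weight R c)`_m * (1 - 'X) ^+ m.+1.
Proof.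
move=> c0; rewrite cycle_poly_weight // coefZ coef_comp_polyZX.
by rewrite mulrA -exprS mulrC.
Qed.

Lemma geom_poly_nneg (R : numDomainType) (a : nat) :
  geom_poly R a \is a polyOver Num.Def.nneg_num_pred.
Proof. by apply/polyOverP => i; rewrite coef_geom_poly unfold_in /= ler0n. Qed.

Lemma cycle_weight_nneg (R : numDomainType) (c : seq nat) :
  cycle_weight R c \is a polyOver (polyOver_pred Num.Def.nneg_num_pred).
Proof.
have [/size0nil->|] := posnP (size c).
  by rewrite polyOverC geom_poly_nneg.
elim/merges_ind => {c} [a|a c c0 IHc IHmerges].
  by rewrite cycle_weight1 polyOverC geom_poly_nneg.
rewrite (cycle_weight_cons _ _ c0) rpredD //.
  by rewrite rpredM // polyOverZ ?polyOverX ?geom_poly_nneg.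
by rewrite big_seq rpred_sum.
Qed.

Lemma cycle_weight_ge0 (R : numDomainType) (c : seq nat) (m i : nat) :
  0 <= (cycle_weight R c)`_m`_i.
Proof. by have /polyOverP/(_ m)/polyOverP/(_ i) := cycle_weight_nneg R c. Qed.

Lemma cycle_weight_cons_ge_geom (R : numDomainType) (a : nat) (c : seq nat)
    (m i : nat) : (0 < size c)%N ->
  (geom_poly R a * (cycle_weight R c)`_m)`_i
  <= (cycle_weight R (a :: c))`_m.+1`_i.
Proof.
move=> c0; rewrite (cycle_weight_cons _ _ c0) -scalerAl coefD coefZ coefXM.
rewrite coef_sum coefD coef_sum lerDl sumr_ge0 // => d _.
exact: cycle_weight_ge0.
Qed.

Lemma cycle_weight_cons_ge_merge (R : numDomainType) (a : nat) (c d : seq nat)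
    (m i : nat) : d \in merges a c ->
  (cycle_weight R d)`_m`_i <= (cycle_weight R (a :: c))`_m`_i.
Proof.
move=> d_merge; have c0 : (0 < size c)%N by case: c d_merge.
rewrite (cycle_weight_cons _ _ c0) (big_rem d) //= addrCA 2!coefD lerDl.
have : (geom_poly R a *: 'X) * cycle_weight R c
    + \sum_(e <- rem d (merges a c)) cycle_weight R e
    \is a polyOver (polyOver_pred Num.Def.nneg_num_pred).
  rewrite rpredD ?rpred_sum // => [|e _]; last exact: cycle_weight_nneg.
  by rewrite rpredM ?cycle_weight_nneg // polyOverZ ?polyOverX ?geom_poly_nneg.
by move/polyOverP/(_ m)/polyOverP/(_ i).
Qed.

Lemma cycle_weight_gt0 (R : numDomainType) (c : seq nat) (m i : nat) :
  all (leq 1) c -> (m < size c)%N -> (i + m < sumn c)%N ->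
  0 < (cycle_weight R c)`_m`_i.
Proof.
move=> c_pos mc im; have c0 := leq_ltn_trans (leq0n m) mc.
move: c0 m i c_pos mc im.
elim/merges_ind => {c} [a|a c c0 IHc IHmerges] m i.
  move=> _; rewrite ltnS leqn0 => /eqP->; rewrite /= !addn0 => ia.
  by rewrite cycle_weight1 coefC coef_geom_poly ia.
move=> /andP[a0 c_pos]; have size_c := leq_size_sumn c_pos.
rewrite /= ltnS leq_eqVlt => /predU1P[->|mc] im.
  rewrite -(prednK c0).
  apply: lt_le_trans (cycle_weight_cons_ge_geom _ _ _ _ c0).
  rewrite (_ : i = minn i a.-1 + (i - minn i a.-1))%N; last by lia.
  apply: coefM_gt0; rewrite ?coef_geom_poly ?geom_poly_nneg //.
  - exact: (polyOverP (cycle_weight_nneg _ _)).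
  - by rewrite (_ : _ < a)%N //; lia.
  - by apply: IHc => //; lia.
case: c => // b c in c0 IHc IHmerges c_pos size_c mc im *.
have d_merge : (a + b :: c)%N \in merges a (b :: c) by apply: mem_head.
apply: lt_le_trans (cycle_weight_cons_ge_merge R m i d_merge).
apply: IHmerges => //; last by rewrite /= -addnA.
by case/andP: c_pos => b0 c_pos; apply/andP; rewrite ltn_addr.
Qed.

Lemma coef_mulps_power_cycle_poly_gt0 (R : numDomainType) (c : seq nat)
    (m k : nat) :
  all (leq 1) c -> (m < size c)%N -> (0 < k < sumn c)%N ->
  0 < coef_mulps (power_seq R m) k (cycle_poly R c)`_m.
Proof.
move=> c_pos mc /andP[k0 kc]; have c0 := leq_ltn_trans (leq0n m) mc.
rewrite coef_cycle_poly_weight // coef_mulpsM coef_mulpsE.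
have term_ge0 i : 0 <= (cycle_weight R c)`_m`_i * eulerian R m (k - i).
  by rewrite mulr_ge0 ?cycle_weight_ge0 ?eulerian_ge0.
pose i := (k - maxn m 1)%N; have ik : (i < k.+1)%N by rewrite ltnS leq_subr.
rewrite (bigD1 (Ordinal ik)) //= ltr_wpDr ?sumr_ge0 //.
have size_c := leq_size_sumn c_pos; rewrite /i mulr_gt0 //.
  by apply: cycle_weight_gt0 => //; lia.
by apply: eulerian_gt0; lia.
Qed.

Definition slice_ehrhart (R : fieldType) (c : seq nat) (k : nat) : {poly R} :=
  \poly_(m < size c) ((size c).-1`!%:R^-1
                      * coef_mulps (power_seq R m) k (cycle_poly R c)`_m).

Section SliceEhrhart.

Variables (R : numFieldType) (c : seq nat) (k : nat).

Lemma coef_slice_ehrhart_gt0 (m : nat) :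
  all (leq 1) c -> (m < size c)%N -> (0 < k < sumn c)%N ->
  0 < (slice_ehrhart R c k)`_m.
Proof.
move=> c_pos mc kc; rewrite coef_poly mc.
by rewrite mulr_gt0 ?coef_mulps_power_cycle_poly_gt0 // invr_gt0 ltr0n fact_gt0.
Qed.

Lemma size_slice_ehrhart :
  all (leq 1) c -> (0 < k < sumn c)%N -> size (slice_ehrhart R c k) = size c.
Proof.
move=> c_pos kc; have c0 : (0 < size c)%N by case: c kc => //=; case: k.
apply: size_poly_eq; rewrite mulf_neq0 ?invr_eq0 ?pnatr_eq0 -?lt0n ?fact_gt0 //.
by rewrite gt_eqF // coef_mulps_power_cycle_poly_gt0 // prednK.
Qed.

End SliceEhrhart.

Lemma horner_shifted_rise_power (R : numFieldType) (n s t j : nat) :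
  (0 < n)%N -> (s <= n)%N -> (0 < t)%N -> (0 < s + j)%N ->
  \sum_(m < n) (n.-1)`!%:R^-1 * (shifted_rise R n s)`_m * t%:R ^+ m
    * power_seq R m j =
  if (s <= t * j)%N then 'C(t * j - s + n.-1, n.-1)%:R else 0.
Proof.
move=> n0 sn t0; case: j => [|j] sj.
  rewrite muln0 leqNgt (_ : 0 < s)%N /=; last by rewrite addn0 in sj.
  by rewrite big1 // => m _; rewrite /power_seq mul0r mulr0.
rewrite -horner_shifted_rise ?muln_gt0 ?t0 // (@horner_coef_wide _ n).
  rewrite mulr_sumr; apply: eq_bigr => m _.
  by rewrite /power_seq mul1r natrM exprMn !mulrA.
by rewrite size_shifted_rise.
Qed.

Lemma prod_geom_poly (R : comNzRingType) (I : Type) (r : seq I) (f : I -> nat) :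
  (1 - 'X) ^+ size r * \prod_(i <- r) geom_poly R (f i) =
  \prod_(i <- r) (1 - 'X^(f i)).
Proof.
under [RHS]eq_bigr do rewrite -geom_polyE.
by rewrite big_split /= big_const_seq count_predT iter_mulr_1.
Qed.

Lemma horner_slice_ehrhart (R : numFieldType) (c : seq nat) (k t : nat) :
  (0 < size c)%N -> (0 < k)%N -> (0 < t)%N ->
  (slice_ehrhart R c k).[t%:R] =
  (\prod_(a <- c) geom_poly R (t * a + 1))`_(t * k).
Proof.
move=> c0 k0 t0; rewrite -(coef_mulps_bin (size c).-1) prednK //.
rewrite prod_geom_poly prod_1subXn_subset_poly linear_sum horner_poly.
under eq_bigr => m _ do rewrite coef_cycle_poly linear_sum mulr_sumr mulr_suml.
rewrite exchange_big; apply: eq_bigr => s _ /=; rewrite coef_mulps_decimate //.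
transitivity (coef_mulps (fun j => \sum_(m < size c)
    ((size c).-1)`!%:R^-1 * (shifted_rise R (size c) s)`_m * t%:R ^+ m
      * power_seq R m j) k (subset_poly R c)`_s).
  rewrite coef_mulps_sumf; apply: eq_bigr => m _.
  by rewrite linearZ /=; ring.
have s_le : (s <= size c)%N by rewrite -ltnS.
have [s0|s_gt0] := posnP s.
  rewrite s0 coef0_subset_poly !coef_mulps1.
  by rewrite (horner_shifted_rise_power _ c0).
apply: eq_coef_mulps => j.
by rewrite horner_shifted_rise_power // addn_gt0 s_gt0.
Qed.

Lemma coef_prod_geom_poly (R : comNzRingType) (n M K : nat) (b : 'I_n -> nat) :
  (forall i, b i <= M)%N ->
  (\prod_i geom_poly R (b i))`_K =
  #|[set f : {ffun 'I_n -> 'I_M} | [forall i, f i < b i]%N &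
      (\sum_i f i == K)%N]|%:R.
Proof.
move=> bM; rewrite /geom_poly.
under eq_bigr => i _ do rewrite (big_ord_widen _ (fun j => 'X^j) (bM i)).
rewrite (bigA_distr_big_dep (fun i (j : 'I_M) => (j < b i)%N)).
rewrite coef_sum -sum1_card natr_sum big_mkcond [RHS]big_mkcond /=.
apply: eq_bigr => f _; rewrite [X in _ = if X then _ else _]inE.
rewrite [X in (if X then _ else _) = _](_ : _ = [forall i, f i < b i]%N) //.
case: ifP => //= _; rewrite -(big_morph _ (exprD 'X) (expr0 'X)) coefXn eq_sym.
by case: eqP.
Qed.

Section LatticePoints.

Variables (R : realType) (n k t : nat) (c : 'I_n -> nat).

Lemma dilate_prism_slice_latticeP (y : 'rV[R]_n) : (0 < t)%N ->
  (dilate t (prism_slice k c) `&` @lattice R n) y <->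
  exists f : 'I_n -> nat,
    [/\ y = \row_i (f i)%:R, forall i, (f i <= t * c i)%N
      & (\sum_i f i = t * k)%N].
Proof.
move=> t0; have t_neq0 : (t%:R : R) != 0 by rewrite pnatr_eq0 -lt0n.
split=> [[[x [x_box x_sum] <-] y_int]|[f [-> f_le f_sum]]].
  have y_nat i : (t%:R *: x) ord0 i \is a Num.nat.
    by rewrite natrEint y_int mxE mulr_ge0 //; case/andP: (x_box i).
  exists (fun i => Num.truncn ((t%:R *: x) ord0 i)); split.
  - by apply/rowP => i; rewrite [RHS]mxE truncnK.
  - move=> i; rewrite -(ler_nat R) truncnK // mxE natrM ler_wpM2l //.
    by case/andP: (x_box i).
  apply/eqP; rewrite -(eqr_nat R) natr_sum.
  under eq_bigr => i _ do rewrite truncnK // mxE.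
  by rewrite -mulr_sumr x_sum natrM.
split; last by move=> i; rewrite mxE intr_nat.
exists (t%:R^-1 *: \row_i (f i)%:R); last by rewrite scalerA mulfV // scale1r.
split=> [i|].
  rewrite !mxE mulr_ge0 ?invr_ge0 //= ler_pdivrMl ?ltr0n // -natrM ler_nat.
  exact: f_le.
under eq_bigr do rewrite !mxE.
by rewrite -mulr_sumr -natr_sum f_sum natrM mulKf.
Qed.

Lemma card_dilate_prism_slice_lattice : (0 < t)%N ->
  exists2 m : nat, dilate t (prism_slice k c) `&` @lattice R n #= `I_m &
    (\prod_i geom_poly R (t * c i + 1))`_(t * k) = m%:R.
Proof.
move=> t0; pose M := (\max_i (t * c i + 1))%N.
have bM i : (t * c i + 1 <= M)%N by apply: leq_bigmax.
rewrite (coef_prod_geom_poly _ _ bM).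
set A := [set f | _ & _]%SET; exists #|A| => //.
pose v (f : {ffun 'I_n -> 'I_M}) : 'rV[R]_n := \row_i (f i)%:R.
have v_inj : injective v.
  move=> f g /rowP fg; apply/ffunP => i; apply/val_inj => /=.
  by have := fg i; rewrite !mxE => /eqP; rewrite eqr_nat => /eqP.
have -> : dilate t (prism_slice k c) `&` @lattice R n =
    [set` [fset v f | f in A]%fset].
  apply/seteqP; split=> y.
    move/(dilate_prism_slice_latticeP _ t0) => [f [-> f_le f_sum]].
    have f_lt i : (f i < M)%N by rewrite (leq_trans _ (bM i)) // addn1 ltnS.
    apply/imfsetP; exists [ffun i => Ordinal (f_lt i)].
      rewrite /= inE; apply/andP; split.
        by apply/forallP => i; rewrite ffunE /= addn1 ltnS.
      by under eq_bigr do rewrite ffunE /=; apply/eqP.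
    by apply/rowP => i; rewrite !mxE ffunE.
  case/imfsetP => f /=; rewrite inE => /andP[/forallP f_lt /eqP f_sum] ->.
  apply/(dilate_prism_slice_latticeP _ t0).
  exists (fun i => nat_of_ord (f i)); split=> // i.
  by have := f_lt i; rewrite addn1 ltnS.
by apply/card_eq_fsetP; rewrite card_imfset //= -cardE.
Qed.

End LatticePoints.

Lemma ehrhart_polynomialI (R : realType) (n : nat) (P : set 'rV[R]_n)
    (p : {poly R}) :
  counts_lattice_points P p -> ehrhart_polynomial P p.
Proof.
move=> p_count; split=> // q q_count; apply: horner_posnat_inj => t t0.
have [m Pm ->] := p_count t t0; have [l Pl ->] := q_count t t0.
by congr _%:R; apply/card_eq_II; apply: card_eq_trans Pl; rewrite card_eq_sym.
Qed.

Theorem theorem1p1 (R : realType) (n : nat) (c : 'I_n -> nat) (k : nat) :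
  (1 <= n)%N ->
  (forall i, (0 < c i)%N) ->
  (0 < k < \sum_(i < n) c i)%N ->
  exists p : {poly R},
    [/\ ehrhart_polynomial (@prism_slice R n k c) p,
        size p = n
      & forall i : nat, (i < n)%N -> 0 < p`_i].
Proof.
move=> n0 c_pos kc; set cs := [seq c i | i <- enum 'I_n].
have size_cs : size cs = n by rewrite size_map size_enum_ord.
have cs_pos : all (leq 1) cs by apply/allP => _ /mapP[i _ ->]; apply: c_pos.
have kcs : (0 < k < sumn cs)%N by rewrite sumnE big_map big_enum.
exists (slice_ehrhart R cs k); split.
- apply: ehrhart_polynomialI => t t0.
  have [m Sm mE] := card_dilate_prism_slice_lattice R k c t0.
  have /andP[k0 _] := kc; exists m => //.
  by rewrite horner_slice_ehrhart ?size_cs // big_map big_enum -mE.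
- by rewrite size_slice_ehrhart.
- by move=> i i_n; rewrite coef_slice_ehrhart_gt0 ?size_cs.
Qed.
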